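(* If $G$ is a compact metric profinite abelian group such that $t(G)$ is dense in $G$, then $G$ is topologically isomorphic to a product of countably many cyclic groups.
   Context: For an abelian group $G$ (written additively), $t(G)=\{x\in G: nx=0 \text{ for some } n\in\mathbb{N}\setminus\{0\}\}$ is its torsion part. ''Compact metric'' means compact and metrizable. Products carry the Tychonoff product topology, with the cyclic factors being (Hausdorff) topological groups; ''countably many'' allows finitely many factors (or trivial factors). ''Topologically isomorphic'' means isomorphic via a group isomorphism that is a homeomorphism. *)

(* Defs.v *)
From HB Require Import structures.
From mathcomp Require Import all_boot all_order all_algebra.
From mathcomp Require Import all_classical all_reals all_analysis.

Set Implicit Arguments.
Unset Strict Implicit.
Unset Printing Implicit Defensive.

Import GRing.Theory.

Local Open Scope classical_set_scope.
Local Open Scope ring_scope.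

(* Pointwise group structure on [prod_topology C], whose topology is already
   the Tychonoff one: the product is again a topological abelian group. *)
Section ProductGroup.
Context {I : Type} (C : I -> topologicalZmodType).
Implicit Types f g h : prod_topology C.

Definition prod_zero : prod_topology C := fun i => 0.
Definition prod_opp f : prod_topology C := fun i => - f i.
Definition prod_add f g : prod_topology C := fun i => f i + g i.

Let prod_addA : associative prod_add.
Proof.
by move=> f g h; apply: functional_extensionality_dep => i; exact: addrA.
Qed.

Let prod_addC : commutative prod_add.
Proof. by move=> f g; apply: functional_extensionality_dep => i; exact: addrC. Qed.

Let prod_add0 : left_id prod_zero prod_add.
Proof. by move=> f; apply: functional_extensionality_dep => i; exact: add0r. Qed.

Let prod_addN : left_inverse prod_zero prod_opp prod_add.
Proof. by move=> f; apply: functional_extensionality_dep => i; exact: addNr. Qed.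

HB.instance Definition _ := GRing.isZmodule.Build (prod_topology C)
  prod_addA prod_addC prod_add0 prod_addN.

Let prod_coord_continuous (i : I) :
  continuous (fun f : prod_topology C => f i).
Proof.
move=> f; have /cvg_sup/(_ i) : nbhs f --> f by exact: cvg_id.
by move=> h; apply: cvg_trans (cvg_app _ h) _; exact: initial_continuous.
Qed.

Let prod_sub_continuous :
  continuous (fun x : prod_topology C * prod_topology C => x.1 - x.2).
Proof.
move=> x; apply/cvg_sup => i; move: x; apply: continuous_comp_initial => x.
apply: (@continuous_comp _ _ _
  (fun y : prod_topology C * prod_topology C => (y.1 i, y.2 i))
  (fun z : C i * C i => z.1 - z.2)); last exact: sub_continuous.
apply: cvg_pair => /=.
  apply: (@continuous_comp _ _ _ fst (fun f : prod_topology C => f i)).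
    exact: cvg_fst.
  exact: prod_coord_continuous.
apply: (@continuous_comp _ _ _ snd (fun f : prod_topology C => f i)).
  exact: cvg_snd.
exact: prod_coord_continuous.
Qed.

HB.instance Definition _ := PreTopologicalNmodule_isTopologicalZmodule.Build
  (prod_topology C) prod_sub_continuous.

End ProductGroup.

Definition torsion (G : zmodType) : set G :=
  [set x | exists2 n : nat, (0 < n)%N & x *+ n = 0].
Arguments torsion G : clear implicits.

Definition cyclic_zmod (G : zmodType) : Prop :=
  exists a : G, forall x : G, exists n : int, x = a *~ n.

Definition homeomorphic (T U : topologicalType) : Prop :=
  exists (f : T -> U) (g : U -> T),
    [/\ cancel f g, cancel g f, continuous f & continuous g].

Definition metrizable (R : realType) (T : topologicalType) : Prop :=
  exists M : metricType R, homeomorphic T M.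

Definition profinite (G : topologicalZmodType) : Prop :=
  [/\ compact [set: G], hausdorff_space G & totally_disconnected [set: G]].

Definition topologically_isomorphic (G H : topologicalZmodType) : Prop :=
  exists (f : G -> H) (g : H -> G),
    [/\ {morph f : x y / x + y}, cancel f g, cancel g f, continuous f
      & continuous g].

(* Main.v *)
Require Import Defs.
From HB Require Import structures.
From mathcomp Require Import all_boot all_order all_algebra.
From mathcomp Require Import all_classical all_reals all_analysis.

(** Write <x> for the cyclic subgroup generated by x. The theorem is the
compact counterpart of Pruefer's theorem that a countable abelian torsion
group without elements of infinite height is a direct sum of cyclic groups.
The proof is carried out inside G, without Pontryagin duality.

Splitting off one cyclic factor ([split_cyclic]). Let U < H be open subgroups
of G. Density of the torsion elements together with compactness gives n > 0
with n G inside U, and taking n minimal yields a prime p for which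
U' = U + p H is still proper in H. By density again H \ U' contains torsion
elements, and even p-primary ones, since p H lies in U'. Choose such an x with
p^(k+1) x = 0 and k minimal. Then every h in H with p^k h = 0 lies in U', hence
p^k x is not in the closed subgroup p^k U', and some open subgroup W
separates p^k x from p^k U'. Let V be a subgroup of H containing p^k U' and W
(intersected with H) that is maximal for not containing p^k x. The quotient
H / V is killed by p^(k+1), and x has order p^(k+1) in it, the largest
possible order; the classical argument that an element of maximal order spans
a direct summand then shows H = V (+) <x> ([maximal_avoiding_disjoint],
[maximal_avoiding_sum]). Since p^k (V + U) lies in V, the element x is not in
V + U.

Iterating ([cyclic_filtration]). Metrizability gives open subgroups U_0, U_1,
... with trivial intersection. Starting from V_0 = G, split
V_n = V_(n+1) (+) <x_n> using the first U_k that does not yet contain V_n.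
While k stays the same, V_n + U_k decreases strictly; a decreasing sequence of
closed subgroups with open intersection is eventually constant by compactness,
so V_n is eventually inside U_k. Therefore the V_n have trivial intersection.

Reassembling ([filtration_product]). Each g in G is the sum of a unique
series a_0 + a_1 + ... with a_n in <x_n>, in the sense that g minus the n-th
partial sum lies in V_n; conversely, compactness makes each such series
converge. The V_n form a basis of neighborhoods of 0, so this bijection
between G and the product of the discrete groups <x_n> is a homeomorphism. *)

Set Implicit Arguments.
Unset Strict Implicit.
Unset Printing Implicit Defensive.

Import Order.TTheory GRing.Theory Num.Theory.

Local Open Scope classical_set_scope.
Local Open Scope ring_scope.

(** * Compactness and clopen sets *)

(** If every D in B met the complement of O, the sets D minus O would generate
a proper filter, and a cluster point of it would lie in all D and not in O. *)
Lemma compact_directed_sub (T : topologicalType) (B : set (set T)) (O : set T) :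
  compact [set: T] -> B !=set0 ->
  (forall D E, B D -> B E -> exists2 F, B F & F `<=` D `&` E) ->
  (forall D, B D -> closed D) -> open O -> \bigcap_(D in B) D `<=` O ->
  exists2 D, B D & D `<=` O.
Proof.
move=> cT B0 Bdir Bcl oO BO; apply: contrapT => noD.
pose F := filter_from B (fun D => D `\` O).
have FF : ProperFilter F.
  apply: filter_from_proper.
    apply: filter_from_filter => // D E BD BE.
    have [K BK sK] := Bdir _ _ BD BE; exists K => // x [/sK[Dx Ex] Ox].
    by split.
  move=> D BD; apply: contrapT => /set0P/negP/negPn/eqP DO0.
  by apply: noD; exists D => //; rewrite -setD_eq0.
have [|x [_ Fx]] := cT F FF; first exact: filterT.
have xC D : B D -> closure (D `\` O) x.
  by move=> BD A nA; apply: Fx => //; exists D.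
have Ox : ~ O x.
  have [D BD] := B0; suff : (~` O) x by [].
  apply: (open_closedC oO); apply: closureS (xC _ BD); exact: subDsetr.
apply/Ox/BO => D BD; apply: (Bcl _ BD); apply: closureS (xC _ BD).
exact: subDsetl.
Qed.

Lemma nested_le (T : Type) (K : nat -> set T) :
  (forall n, K n.+1 `<=` K n) ->
  forall m n, (m <= n)%N -> K n `<=` K m.
Proof.
move=> Kdec m n /subnK <-; elim: (n - m)%N => [//|d IH].
by rewrite addSn; apply: subset_trans (Kdec _) IH.
Qed.

Lemma compact_nested_sub (T : topologicalType) (K : nat -> set T) (O : set T) :
  compact [set: T] -> (forall n, K n.+1 `<=` K n) -> (forall n, closed (K n)) ->
  open O -> \bigcap_n K n `<=` O -> exists n, K n `<=` O.
Proof.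
move=> cT Kdec Kcl oO KO.
have [| | | |D [n _ <-] sD] :=
  @compact_directed_sub T (range K) O cT _ _ _ oO _.
- by exists (K 0%N); exists 0%N.
- move=> _ _ [m _ <-] [n _ <-].
  exists (K (maxn m n)); first by exists (maxn m n).
  by move=> x Kx; split; apply: (nested_le Kdec) Kx;
    [exact: leq_maxl|exact: leq_maxr].
- by move=> _ [n _ <-].
- by move=> x Kx; apply: KO => n _; apply: Kx; exists n.
- by exists n.
Qed.

(** The intersection Q of the clopen sets containing x is connected, so it is
reduced to x when the space is totally disconnected; two points that no clopen
set separates share the same Q. *)
Lemma totally_disconnected_zero_dimensional (T : topologicalType) :
  compact [set: T] -> hausdorff_space T -> totally_disconnected [set: T] ->
  zero_dimensional T.
Proof.
move=> cT hT tdT x y /eqP xy; apply: contrapT => nosep; apply: xy.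
pose B := [set D : set T | clopen D /\ D x].
pose Q := \bigcap_(D in B) D.
have Qx : Q x by move=> D [].
have Qy : Q y.
  by move=> D [cD Dx]; apply: contrapT => nDy; apply: nosep; exists D.
have BI D E : B D -> B E -> B (D `&` E).
  by move=> [cD Dx] [cE Ex]; split=> //; exact: clopenI.
have Qcl : closed Q by apply: closed_bigI => D [[]].
suff cQ : connected Q.
  have : connected_component [set: T] x y by exists Q.
  by rewrite tdT.
have nT := compact_normal hT cT.
(* By normality a closed partition of Q is separated by disjoint open sets U
   and V; some clopen D around x lies in their union, and then the trace of U
   on D, which is also D minus V, is a clopen set containing x. *)
have half A C : closed A -> closed C -> A `&` C = set0 -> Q `<=` A `|` C ->
    A x -> Q `<=` A.
  move=> clA clC AC QAC Ax.
  have [|W nW WC] := nT _ clA (~` C).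
    apply/set_nbhsP; exists (~` C); split=> //; first exact: closed_openC.
    exact/disjoints_subset.
  have [U [oU AU UW]] := (set_nbhsP _ _).1 nW.
  pose V := ~` closure W.
  have oV : open V by apply: closed_openC; exact: closed_closure.
  have CV : C `<=` V by apply: subsetCr.
  have UV : U `&` V = set0.
    by apply/seteqP; split=> // z [/UW /subset_closure Wz].
  have [| | | | |D [[oD clD] Dx] DUV] := @compact_directed_sub T B (U `|` V) cT.
  - by exists setT; split=> //; exact: clopenT.
  - by move=> D E BD BE; exists (D `&` E) => //; exact: BI.
  - by move=> D [[]].
  - exact: openU.
  - by move=> z /QAC[/AU|/CV]; [left|right].
  have DU : D `&` U = D `&` ~` V.
    apply/seteqP; split=> z [Dz]; last by move=> nVz; case: (DUV _ Dz).
    by move=> Uz; split=> // Vz; suff: set0 z by []; rewrite -UV.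
  have BDU : B (D `&` U).
    split; last by split=> //; exact: AU.
    split; first exact: openI.
    by rewrite DU; apply: closedI => //; exact: open_closedC.
  move=> z Qz; have [//|/CV Vz] := QAC _ Qz.
  have [_ Uz] := Qz _ BDU.
  by suff: set0 z by []; rewrite -UV.
move=> A [a Aa] [P oP AP] [C clC AC].
have clA : closed A by rewrite AC; exact: closedI.
have clA' : closed (Q `&` ~` P) by apply: closedI => //; exact: open_closedC.
have dj : A `&` (Q `&` ~` P) = set0.
  by apply/seteqP; split=> // z []; rewrite {1}AP => -[_ Pz] [_].
have cov : Q `<=` A `|` (Q `&` ~` P).
  by move=> z Qz; have [Pz|nPz] := pselect (P z); [left; rewrite AP|right].
have [Ax|/= [_ nPx]] := cov _ Qx.
  apply/seteqP; split; first by rewrite AP; exact: subIsetl.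
  exact: half clA clA' dj cov Ax.
have : Q `<=` Q `&` ~` P.
  by apply: (half _ A) => //; [rewrite setIC|rewrite setUC].
by move: Aa; rewrite AP => -[Qa Pa] /(_ _ Qa)[].
Qed.

(** * Subgroups of an abelian group *)

Section Subgroups.
Variable G : zmodType.
Implicit Types (A B H N V : set G) (x y : G).

Definition subgroup A := A 0 /\ forall x y, A x -> A y -> A (x - y).

Section Closure.
Variables (A : set G) (sA : subgroup A).

Lemma subgroupN x : A x -> A (- x).
Proof. by case: sA => A0 AB Ax; rewrite -sub0r; exact: AB. Qed.

Lemma subgroupD x y : A x -> A y -> A (x + y).
Proof.
by move=> Ax Ay; rewrite -[y]opprK; apply: sA.2 => //; exact: subgroupN.
Qed.

Lemma subgroupMn x n : A x -> A (x *+ n).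
Proof.
move=> Ax; elim: n => [|n IH]; first by rewrite mulr0n; exact: sA.1.
by rewrite mulrS; exact: subgroupD.
Qed.

Lemma subgroupMz x (n : int) : A x -> A (x *~ n).
Proof.
by move=> Ax; case: n => n; [|apply: subgroupN]; exact: subgroupMn.
Qed.

End Closure.

Lemma subgroupI A B : subgroup A -> subgroup B -> subgroup (A `&` B).
Proof.
move=> sA sB; split; first by split; [exact: sA.1|exact: sB.1].
by move=> x y [Ax Bx] [Ay By]; split; [exact: sA.2|exact: sB.2].
Qed.

Definition sumset A B : set G := [set a + b | a in A & b in B].

Lemma subgroup_sumset A B : subgroup A -> subgroup B -> subgroup (sumset A B).
Proof.
move=> sA sB; split.
  by exists 0; [exact: sA.1|exists 0; [exact: sB.1|rewrite addr0]].
move=> _ _ [a Aa [b Bb <-]] [a' Aa' [b' Bb' <-]].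
exists (a - a'); first exact: sA.2.
by exists (b - b'); [exact: sB.2|rewrite addrACA -opprD].
Qed.

Lemma sub_sumsetl A B : subgroup B -> A `<=` sumset A B.
Proof.
by move=> sB a Aa; exists a => //; exists 0; [exact: sB.1|rewrite addr0].
Qed.

Lemma sub_sumsetr A B : subgroup A -> B `<=` sumset A B.
Proof.
by move=> sA b Bb; exists 0; [exact: sA.1|exists b => //; rewrite add0r].
Qed.

Lemma sumset_sub A B H :
  subgroup H -> A `<=` H -> B `<=` H -> sumset A B `<=` H.
Proof.
by move=> sH AH BH _ [a /AH Ha [b /BH Hb <-]]; exact: subgroupD.
Qed.

Definition multiples A n : set G := [set a *+ n | a in A].

Lemma subgroup_multiples A n : subgroup A -> subgroup (multiples A n).
Proof.
move=> sA; split; first by exists 0; [exact: sA.1|rewrite mul0rn].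
move=> _ _ [a Aa <-] [b Ab <-]; exists (a - b); first exact: sA.2.
by rewrite mulrnBl.
Qed.

Lemma multiples_sub A n : subgroup A -> multiples A n `<=` A.
Proof. by move=> sA _ [a Aa <-]; exact: subgroupMn. Qed.

Definition cyclic_subgroup x : set G := range (fun n : int => x *~ n).

Lemma subgroup_cyclic x : subgroup (cyclic_subgroup x).
Proof.
split; first by exists 0; rewrite // mulr0z.
by move=> _ _ [m _ <-] [n _ <-]; exists (m - n); rewrite // mulrzBr.
Qed.

Lemma cyclic_subgroup_id x : cyclic_subgroup x x.
Proof. by exists 1; rewrite // mulr1z. Qed.

Lemma cyclic_subgroup_sub x A : subgroup A -> A x -> cyclic_subgroup x `<=` A.
Proof. by move=> sA Ax _ [n _ <-]; exact: subgroupMz. Qed.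

(** The internal direct sum H = V (+) <x>. *)
Definition cyclic_splitting H V x :=
  [/\ V `<=` H, H x, V `&` cyclic_subgroup x `<=` [set 0]
    & H `<=` sumset V (cyclic_subgroup x)].

(** Among the subgroups of H, V is maximal for the property of not containing
y. The second clause is the form in which maximality is used: adding to V any
further element of H captures y. *)
Definition maximal_avoiding H y V :=
  ~ V y /\ forall g, H g -> ~ V g -> sumset V (cyclic_subgroup g) y.

Lemma exists_maximal_avoiding H N y :
  subgroup H -> subgroup N -> N `<=` H -> ~ N y ->
  exists V, [/\ subgroup V, N `<=` V, V `<=` H & maximal_avoiding H y V].
Proof.
move=> sH sN NH nNy.
pose P V := [/\ subgroup V, N `<=` V, V `<=` H & ~ V y].
(* The empty set is admitted because it is the union of the empty chain. *)
have [|V [PV Vmax]] := @Zorn_bigcup G [set V | V = set0 \/ P V].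
  move=> F FP totF.
  have [->|/set0P[a [A FA Aa]]] := eqVneq (\bigcup_(X in F) X) set0.
    by left.
  have PX X b : F X -> X b -> P X by move=> /FP[->|].
  right; split.
  - split; first by exists A => //; have [[]] := PX _ _ FA Aa.
    move=> b c [X FX Xb] [Y FY Yc]; have [XY|YX] := totF _ _ FX FY.
      exists Y => //; have [[_ YB] _ _ _] := PX _ _ FY Yc.
      by apply: YB => //; exact: XY.
    exists X => //; have [[_ XB] _ _ _] := PX _ _ FX Xb.
    by apply: XB => //; exact: YX.
  - by move=> n Nn; exists A => //; have [_ + _ _] := PX _ _ FA Aa; exact.
  - by move=> b [X FX Xb]; have [_ _ + _] := PX _ _ FX Xb; exact.
  - by move=> [X FX Xy]; have [_ _ _] := PX _ _ FX Xy.
have {}PV : P V.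
  case: PV => // V0; case: (Vmax N); last by right; split.
  by rewrite V0; split=> // /(_ _ sN.1).
have [sV NV VH nVy] := PV; exists V; split=> //; split=> // g Hg nVg.
apply: contrapT => nSy; have sC := subgroup_cyclic g.
apply: (Vmax (sumset V (cyclic_subgroup g))).
  split; first exact: sub_sumsetl.
  move=> E; apply/nVg/E/sub_sumsetr => //; exact: cyclic_subgroup_id.
right; split=> //; first exact: subgroup_sumset.
  by apply: subset_trans NV _; exact: sub_sumsetl.
by apply: sumset_sub => //; exact: cyclic_subgroup_sub.
Qed.

Lemma subgroup_coprime A x (m n : int) :
  subgroup A -> coprimez m n -> A (x *~ m) -> A (x *~ n) -> A x.
Proof.
move=> sA /coprimezP[[u v] /= uv] Am An.
rewrite -[x]mulr1z -uv mulrzDr; apply: subgroupD => //.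
  by rewrite mulrC mulrzA; exact: subgroupMz.
by rewrite mulrC mulrzA; exact: subgroupMz.
Qed.

Lemma coprimez_prime (p : nat) (n : int) :
  prime p -> coprimez n p = ~~ (p %| n)%Z.
Proof. by move=> pp; rewrite coprimezE coprime_sym prime_coprime. Qed.

Section Complement.
Variables (p k : nat) (H V : set G) (x : G).
Hypotheses (p_prime : prime p) (sH : subgroup H) (sV : subgroup V).
Hypotheses (Hx : H x) (x_ord : x *+ p ^ k.+1 = 0).
Hypothesis (H_exp : forall h, H h -> V (h *+ p ^ k.+1)).
Hypothesis (V_max : maximal_avoiding H (x *+ p ^ k) V).

(** The subgroup <x> has order p ^ k.+1, so each of its nonzero subgroups
contains p ^ k x, which V avoids. *)
Lemma maximal_avoiding_disjoint : V `&` cyclic_subgroup x `<=` [set 0].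
Proof.
move=> z [Vz [j _ zj]]; rewrite -zj in Vz * => /= {z zj}.
have [u [w uw]] := Bezoutz j (p ^ k.+1)%N.
have : V (x *~ gcdz j (p ^ k.+1)%N).
  rewrite -uw mulrzDr; apply: subgroupD => //.
    by rewrite mulrC mulrzA; exact: subgroupMz.
  by rewrite mulrC mulrzA -pmulrn x_ord mul0rz; exact: sV.1.
have : (gcdn `|j| (p ^ k.+1) %| p ^ k.+1)%N by exact: dvdn_gcdr.
rewrite /gcdz /= => /dvdn_pfactor[//|i]; rewrite leq_eqVlt => /predU1P[->|].
  move=> gE _.
  have /dvdzP[c ->] : ((p ^ k.+1)%N %| j)%Z by rewrite dvdzE /= -gE dvdn_gcdl.
  by rewrite mulrC mulrzA -pmulrn x_ord mul0rz.
rewrite ltnS => ik ->; rewrite -pmulrn => Vi; case: V_max => /[swap] _; case.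
by rewrite -(subnKC ik) expnD mulrnA; exact: subgroupMn.
Qed.

(** As p ^ k.+1 H lies in V, it is enough that V + <x> be closed under division
by p in H. If p h = v + j x, multiplying by p ^ k and using that V and <x> are
disjoint shows that p divides j, so that subtracting a multiple of x from h
leaves h' with p h' in V. If h' is not in V, maximality expresses p ^ k x as an
element of V plus l h'; here l is prime to p, so h' lies in V + <x>. *)
Lemma maximal_avoiding_sum : H `<=` sumset V (cyclic_subgroup x).
Proof.
have [nVy Vmax] := V_max.
pose S := sumset V (cyclic_subgroup x).
have sC := subgroup_cyclic x.
have sS : subgroup S by exact: subgroup_sumset.
have VS : V `<=` S by exact: sub_sumsetl.
have CS : cyclic_subgroup x `<=` S by exact: sub_sumsetr.
have root h : H h -> S (h *+ p) -> S h.
  move=> Hh [v Vv [_ [j _ <-] /esym hp]].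
  have xjp : x *~ (j * (p ^ k)%N) = 0.
    apply: maximal_avoiding_disjoint; split; last by exists (j * (p ^ k)%N).
    have -> : x *~ (j * (p ^ k)%N) = h *+ p ^ k.+1 - v *+ p ^ k.
      by rewrite expnS mulrnA hp mulrnDl mulrzA addrC addKr.
    by apply: sV.2; [exact: H_exp|exact: subgroupMn].
  have /dvdzP[i ji] : (p %| j)%Z.
    rewrite -[(_ %| _)%Z]negbK -coprimez_prime //; apply/negP => jp; apply: nVy.
    apply: (subgroup_coprime sV jp); rewrite [x *+ _]pmulrn -mulrzA mulrC.
      by rewrite xjp; exact: sV.1.
    by rewrite -PoszM -expnS -pmulrn x_ord; exact: sV.1.
  pose h' := h - x *~ i.
  have Hh' : H h' by apply: sH.2 => //; exact: subgroupMz.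
  have h'p : h' *+ p = v by rewrite mulrnBl hp ji mulrzA addrK.
  suff Sh' : S h'.
    rewrite -[h](subrK (x *~ i)); apply: subgroupD => //.
    by apply: CS; exists i.
  have [/VS//|nVh'] := pselect (V h').
  have [v' Vv' [_ [l _ <-] vl]] := Vmax _ Hh' nVh'.
  have lp : coprimez l p.
    rewrite coprimez_prime //; apply/negP => /dvdzP[c lE]; apply: nVy.
    rewrite -vl lE mulrC mulrzA -pmulrn h'p; apply: subgroupD => //.
    exact: subgroupMz.
  apply: (subgroup_coprime sS lp); last by rewrite -pmulrn h'p; exact: VS.
  have -> : h' *~ l = x *+ p ^ k - v' by rewrite -vl addrC addKr.
  by apply: sS.2; [apply: CS; exists (p ^ k)%N; rewrite // -pmulrn|exact: VS].
have roots i h : H h -> S (h *+ p ^ i) -> S h.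
  elim: i h => [|i IH] h Hh; first by rewrite expn0 mulr1n.
  rewrite expnS mulrnA => /IH Shp; apply: root => //; apply: Shp.
  exact: subgroupMn.
by move=> h Hh; apply: (roots k.+1) => //; apply/VS/H_exp.
Qed.

End Complement.
End Subgroups.

(** * Open subgroups of profinite groups *)

Section TopologicalSubgroups.
Variable G : topologicalZmodType.
Implicit Types (A H K U V W : set G) (x y g : G).

Lemma mulrn_continuous n : continuous (fun g : G => g *+ n).
Proof.
elim: n => [|n IH] g; first by rewrite /continuous_at mulr0n; exact: cvg_cst.
rewrite /continuous_at mulrS.
rewrite -(@eq_cvg _ _ _ (fun h => h + h *+ n)); last by move=> h; rewrite mulrS.
apply: (@continuous_comp _ _ _
  (fun h : G => (h, h *+ n)) (fun z : G * G => z.1 + z.2)).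
  by apply: cvg_pair; [exact: cvg_id|exact: IH].
exact: add_continuous.
Qed.

Lemma subr_continuous x : continuous (fun g : G => g - x).
Proof.
move=> g.
apply: (@continuous_comp _ _ _
  (fun h : G => (h, x)) (fun z : G * G => z.1 - z.2)).
  by apply: cvg_pair; [exact: cvg_id|exact: cvg_cst].
exact: sub_continuous.
Qed.

Lemma nbhs_translate x A : nbhs 0 A -> nbhs x [set y | A (y - x)].
Proof. by rewrite -(subrr x) => /subr_continuous. Qed.

Definition open_subgroup A := subgroup A /\ open A.

Lemma subgroup_nbhs_open A : subgroup A -> nbhs 0 A -> open_subgroup A.
Proof.
move=> sA nA; split=> //; rewrite openE => x Ax.
apply: filterS (nbhs_translate x nA) => y /= Ayx.
by rewrite -(subrK x y); exact: subgroupD.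
Qed.

Lemma open_subgroup_nbhs A : open_subgroup A -> nbhs 0 A.
Proof. by move=> [[A0 _] oA]; apply: open_nbhs_nbhs. Qed.

Lemma open_subgroupS A B : open_subgroup A -> subgroup B -> A `<=` B ->
  open_subgroup B.
Proof.
move=> oA sB AB; apply: subgroup_nbhs_open => //.
by apply: filterS AB _; exact: open_subgroup_nbhs.
Qed.

Lemma open_subgroupI A B :
  open_subgroup A -> open_subgroup B -> open_subgroup (A `&` B).
Proof.
by move=> [sA oA] [sB oB]; split; [exact: subgroupI|exact: openI].
Qed.

Lemma open_subgroup_closed A : open_subgroup A -> closed A.
Proof.
move=> oA; have [sA _] := oA; rewrite -(setCK A); apply: open_closedC.
rewrite openE => x nAx.
apply: filterS (nbhs_translate x (open_subgroup_nbhs oA)) => y /= Ayx Ay.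
by apply: nAx; rewrite -(subKr y x); exact: sA.2.
Qed.

(** A clopen set K containing 0 contains its own stabilizer under translation,
which is a neighborhood of 0 because K is compact and open. *)
Lemma profinite_small_subgroup A : profinite G -> nbhs 0 A ->
  exists2 W, open_subgroup W & W `<=` A.
Proof.
move=> [cG hG dG] nA.
have zG := totally_disconnected_zero_dimensional cG hG dG.
have [K [K0 [oK clK]] KA] := zero_dimensional_cvg hG zG cG nA.
pose S := [set g : G | forall k, K k <-> K (k + g)].
have sS : subgroup S.
  split=> [k|g h Sg Sh k]; first by rewrite addr0.
  by rewrite (Sg k) (Sh (k + (g - h))) addrA subrK.
exists S; last by move=> g /(_ 0) [/(_ K0)]; rewrite add0r => /KA.
apply: subgroup_nbhs_open => //.
have /compact_near_coveringP nc := cG.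
have {}nc := nc G (nbhs (0 : G)) (fun g k => K k <-> K (k + g)) (nbhs_filter 0).
apply: filterS (nc _) => [g gK k|k _]; first exact: gK.
have addc B : open B -> B k ->
    \forall k' \near k & g \near (0 : G), B k' /\ B (k' + g).
  move=> oB Bk; apply: filterI.
    exists (B, setT) => /=; last by move=> z [].
    by split; [exact: open_nbhs_nbhs|exact: filterT].
  apply: (@add_continuous G (k, 0)) => /=; rewrite addr0.
  exact: open_nbhs_nbhs.
have [Kk|nKk] := pselect (K k).
  by apply: filterS (addc _ oK Kk) => z [].
by apply: filterS (addc (~` K) (closed_openC clK) nKk) => z [].
Qed.

Lemma metrizable_subgroup_sequence (R : realType) :
  profinite G -> metrizable R G ->
  exists U : nat -> set G, (forall n, open_subgroup (U n)) /\
    \bigcap_n U n `<=` [set 0].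
Proof.
move=> pG [M [f [g [fK gK fc gc]]]].
have small n :
    exists W, open_subgroup W /\ W `<=` f @^-1` ball (f 0) n.+1%:R^-1.
  have [|W oW WA] :=
    @profinite_small_subgroup (f @^-1` ball (f 0) n.+1%:R^-1) pG.
    by apply: fc; apply: nbhsx_ballx; rewrite invr_gt0.
  by exists W.
have [U UP] := choice small.
exists U; split=> [n|h Uh]; first by have [] := UP n.
apply: contrapT => h0; have d0 : 0 < mdist (f 0) (f h).
  by rewrite mdist_gt0; apply/eqP => /(can_inj fK)/esym.
have [n] := ltr_add_invr d0; rewrite add0r => nd.
have [_ /(_ _ (Uh n I))] := UP n.
by rewrite /= ballEmdist /= => /(lt_trans nd); rewrite ltxx.
Qed.

(** Every g is congruent modulo U to a torsion element, so that n`! g lies in U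
for n large; by compactness one n serves for all g. *)
Lemma dense_torsion_exponent U :
  compact [set: G] -> dense (torsion G) -> open_subgroup U ->
  exists2 n, (0 < n)%N & forall g, U (g *+ n).
Proof.
move=> cG dG oU; have [sU _] := oU.
have [||||n nU] :=
  @compact_nested_sub G (fun n => [set g | ~ U (g *+ n`!)]) set0 cG.
- move=> n g /= nUg Ug; apply: nUg; rewrite factS mulnC mulrnA.
  exact: subgroupMn.
- move=> n; apply: (@preimage_closed _ _ (fun g : G => g *+ n`!) (~` U)).
    by move=> g _; exact: mulrn_continuous.
  by apply: open_closedC; exact: oU.2.
- exact: open0.
- move=> g Ug.
  have : nbhs g [set y | U (y - g)].
    by apply: nbhs_translate; exact: open_subgroup_nbhs.
  rewrite nbhsE => -[B [oB Bg] BU].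
  have [t [Bt [n n0 tn]]] : B `&` torsion G !=set0 by apply: dG => //; exists g.
  apply: (Ug n I); rewrite -[g *+ _]opprK; apply: subgroupN => //.
  have -> : - (g *+ n`!) = (t - g) *+ n`!.
    rewrite mulrnBl; suff -> : t *+ n`! = 0 by rewrite sub0r.
    have /dvdnP[c ->] : (n %| n`!)%N by apply: dvdn_fact; rewrite n0 leqnn.
    by rewrite mulnC mulrnA tn mul0rn.
  by apply: subgroupMn => //; exact: BU.
- by exists n`!; rewrite ?fact_gt0 // => g; apply: contrapT => /nU.
Qed.

End TopologicalSubgroups.

(** * Splitting off cyclic summands *)

Section Splitting.
Variable G : topologicalZmodType.
Hypotheses (pG : profinite G) (dG : dense (torsion G)).
Implicit Types (H U V W : set G) (x y g h : G).

(** Take n > 0 minimal with n H inside U, and p a prime factor of n: if H were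
contained in U + p H, then (n / p) H would be contained in U + n H = U. *)
Lemma exists_prime_proper H U :
  open_subgroup H -> open_subgroup U -> ~ H `<=` U ->
  exists2 p, prime p & ~ H `<=` sumset U (multiples H p).
Proof.
move=> oH oU nHU; have [cG _ _] := pG; have [sU _] := oU.
pose killed n := (0 < n)%N && `[< forall h, H h -> U (h *+ n) >].
have ex : exists n, killed n.
  have [n n0 nU] := dense_torsion_exponent cG dG oU.
  by exists n; rewrite /killed n0; apply/asboolP => h _.
case: (ex_minnP ex) => n /andP[n0 /asboolP nU] n_min.
have n1 : (1 < n)%N.
  rewrite ltn_neqAle n0 andbT; apply/eqP => n1; apply: nHU => h /nU.
  by rewrite -n1 mulr1n.
exists (pdiv n); first exact: pdiv_prime.
have /dvdnP[m nE] := pdiv_dvd n; have p1 := prime_gt1 (pdiv_prime n1).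
have m0 : (0 < m)%N by move: n0; rewrite nE muln_gt0 => /andP[].
move=> HU; have /n_min : killed m.
  rewrite /killed m0; apply/asboolP => _ /HU[u Uu [_ [h Hh <-] <-]].
  rewrite mulrnDl -mulrnA [(pdiv n * m)%N]mulnC -nE.
  by apply: subgroupD => //; [exact: subgroupMn|exact: nU].
by rewrite leqNgt [X in (_ < X)%N]nE -{1}[m]muln1 ltn_pmul2l // p1.
Qed.

(** The r-th multiple of a torsion element t outside U, where r is the part of
the order prime to p, stays outside U because p t is in U. *)
Lemma exists_primary_torsion H U p : prime p ->
  open_subgroup H -> open_subgroup U -> multiples H p `<=` U -> ~ H `<=` U ->
  exists e y, [/\ H y, ~ U y & y *+ p ^ e = 0].
Proof.
move=> p_prime [sH oH] oU pHU nHU; have [sU _] := oU.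
have [t [[Ht nUt] [n n0 tn]]] : (H `\` U) `&` torsion G !=set0.
  apply: dG.
    apply: contrapT => HU0; apply: nHU => h Hh; apply: contrapT => nUh.
    by apply: HU0; exists h.
  by apply: openI => //; apply: closed_openC; exact: open_subgroup_closed.
have [r pr nE] := pfactor_coprime p_prime n0.
exists (logn p n), (t *+ r); split; first exact: subgroupMn.
  move=> Utr; apply: nUt.
  have rp : coprimez r p by rewrite coprimezE coprime_sym.
  apply: (subgroup_coprime sU rp); rewrite -pmulrn //.
  by apply: pHU; exists t.
by rewrite -mulrnA -nE.
Qed.

(** The condition that x is not in V + U makes the splitting progress towards U:
passing from H to V strictly shrinks the image in G / U. *)
Lemma split_cyclic H U :
  open_subgroup H -> open_subgroup U -> U `<=` H -> ~ H `<=` U ->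
  exists x V, [/\ open_subgroup V, cyclic_splitting H V x & ~ sumset V U x].
Proof.
move=> oH oU UH nHU; have [cG hG _] := pG.
have [p p_prime] := exists_prime_proper oH oU nHU.
set U' := sumset _ _ => nHU'.
have [[sH _] [sU _]] := (oH, oU); have sp := subgroup_multiples p sH.
have UU' : U `<=` U' by exact: sub_sumsetl.
have pU' : multiples H p `<=` U' by exact: sub_sumsetr.
have oU' : open_subgroup U'.
  by apply: open_subgroupS oU _ UU'; exact: subgroup_sumset.
have [sU' _] := oU'.
have U'H : U' `<=` H by apply: sumset_sub => //; exact: multiples_sub.
pose primary e := `[< exists y, [/\ H y, ~ U' y & y *+ p ^ e = 0] >].
have ex : exists e, primary e.
  have [e [y yP]] := exists_primary_torsion p_prime oH oU' pU' nHU'.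
  by exists e; apply/asboolP; exists y.
case: (ex_minnP ex) => -[|k] /asboolP[x [Hx nU'x x_ord]] k_min.
  by case: nU'x; rewrite -(mulr1n x) x_ord; exact: sU'.1.
(* Minimality of k: elements killed by p ^ k cannot lie outside U'. *)
have socle y : H y -> y *+ p ^ k = 0 -> U' y.
  move=> Hy yk; apply: contrapT => nU'y.
  suff /k_min : primary k by rewrite ltnn.
  by apply/asboolP; exists y.
pose C := multiples U' (p ^ k).
have sC : subgroup C by exact: subgroup_multiples.
have nCx : ~ C (x *+ p ^ k).
  move=> [u U'u uk]; apply: nU'x; rewrite -(subrK u x); apply: subgroupD => //.
  apply: socle; first by apply: sH.2 => //; exact: U'H.
  by rewrite mulrnBl uk subrr.
have clC : closed C.
  apply: compact_closed => //; apply: continuous_compact.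
    by apply: continuous_subspaceT => g; exact: mulrn_continuous.
  exact: (subclosed_compact (open_subgroup_closed oU') cG (@subsetT _ _)).
have [W oW WC] :
    exists2 W, open_subgroup W & W `<=` [set w | ~ C (w + x *+ p ^ k)].
  apply: profinite_small_subgroup => //.
  have nC : nbhs (x *+ p ^ k) (~` C).
    by apply: open_nbhs_nbhs; split=> //; exact: closed_openC.
  have := @subr_continuous G (- (x *+ p ^ k)) 0.
  rewrite /continuous_at /= sub0r opprK.
  by move=> /(_ _ nC).
have oWH := open_subgroupI oW oH; have [sWH _] := oWH.
pose N := sumset C (W `&` H).
have nNx : ~ N (x *+ p ^ k).
  move=> [c Cc [w [Ww _] cw]]; apply: (WC (- w)).
    by case: oW => sW _; exact: subgroupN.
  by rewrite -cw addrC addrK.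
have NH : N `<=` H.
  apply: sumset_sub => //; apply: subset_trans U'H.
  exact: multiples_sub.
have sN : subgroup N by exact: subgroup_sumset.
have [V [sV NV VH Vmax]] := exists_maximal_avoiding sH sN NH nNx.
have CV : C `<=` V by apply: subset_trans NV; exact: sub_sumsetl.
have H_exp h : H h -> V (h *+ p ^ k.+1).
  move=> Hh; apply: CV; exists (h *+ p); last by rewrite -mulrnA -expnS.
  by apply: pU'; exists h.
exists x, V; split.
- by apply: open_subgroupS oWH sV _; apply: subset_trans NV; exact: sub_sumsetr.
- split=> //; first exact: maximal_avoiding_disjoint p_prime sV x_ord Vmax.
  exact: maximal_avoiding_sum p_prime sH sV Hx x_ord H_exp Vmax.
move=> [v Vv [u Uu vu]]; case: Vmax => + _; apply; rewrite -vu mulrnDl.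
apply: subgroupD => //; first exact: subgroupMn.
by apply: CV; exists u => //; exact: UU'.
Qed.

(** Each step aims at the first U k not containing the current subgroup. *)
Lemma cyclic_filtration (U : nat -> set G) :
  (forall n, open_subgroup (U n)) -> \bigcap_n U n `<=` [set 0] ->
  exists (V : nat -> set G) (x : nat -> G),
    [/\ V 0%N = setT, forall n, open_subgroup (V n),
      forall n, cyclic_splitting (V n) (V n.+1) (x n)
      & \bigcap_n V n `<=` [set 0]].
Proof.
move=> oU U0; have [cG _ _] := pG.
have step H : exists z : G * set G, open_subgroup H ->
    [/\ open_subgroup z.2, cyclic_splitting H z.2 z.1 &
      forall k, (forall j, (j < k)%N -> H `<=` U j) -> ~ H `<=` U k ->
        ~ sumset z.2 (U k `&` H) z.1].
  have [oH|] := pselect (open_subgroup H); last by exists (0, H).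
  have [sH _] := oH.
  have [HU|/existsNP nHU] := pselect (forall k, H `<=` U k).
    exists (0, H) => _; split=> //=.
    split=> //; first exact: sH.1.
      by move=> _ [_ [n _ <-]]; rewrite /= mul0rz.
    by apply: sub_sumsetl; exact: subgroup_cyclic.
  have ex : exists k, `[< ~ H `<=` U k >].
    by have [k nk] := nHU; exists k; apply/asboolP.
  case: (ex_minnP ex) => k /asboolP nk k_min.
  have [||x [V [oV Vx nx]]] := split_cyclic oH (open_subgroupI (oU k) oH).
  - exact: subIsetr.
  - by move=> /subset_trans/(_ (@subIsetl _ _ _)).
  exists (x, V) => _; split=> // i lti nHi; suff -> : i = k by [].
  apply/eqP; rewrite eqn_leq k_min ?andbT; last exact/asboolP.
  by rewrite leqNgt; apply/negP => /lti.
have [f fP] := choice step.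
pose V n := iter n (fun H => (f H).2) setT; pose x n := (f (V n)).1.
have oV n : open_subgroup (V n).
  elim: n => [|n IH]; first by split; [split|exact: openT].
  by have [] := fP _ IH.
have Vx n : cyclic_splitting (V n) (V n.+1) (x n) by have [] := fP _ (oV n).
have Vdec n : V n.+1 `<=` V n by have [] := Vx n.
have Vle := nested_le Vdec.
exists V, x; split=> //.
have below k : exists n, forall j, (j < k)%N -> V n `<=` U j.
  elim: k => [|k [n0 n0P]]; first by exists 0%N.
  suff [i VU] : exists i, V (n0 + i)%N `<=` U k.
    exists (n0 + i)%N => j; rewrite ltnS leq_eqVlt => /predU1P[->//|/n0P].
    by apply: subset_trans; apply: Vle; exact: leq_addr.
  apply: contrapT => /forallNP nVU.
  (* Otherwise every later step aims at U k and makes W decrease strictly,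
     whereas W is eventually equal to its intersection, which is open. *)
  pose W i := sumset (V (n0 + i)%N) (U k).
  have sW i : subgroup (W i).
    by apply: subgroup_sumset; [case: (oV (n0 + i)%N)|case: (oU k)].
  have UW i : U k `<=` W i by apply: sub_sumsetr; case: (oV (n0 + i)%N).
  have [||||i Wi] := @compact_nested_sub G W (\bigcap_i W i) cG.
  - move=> i _ [v Vv [u Uu <-]]; exists v; last by exists u.
    by apply: Vdec; rewrite -addnS.
  - move=> i; apply: open_subgroup_closed; exact: open_subgroupS (oU k) _ (UW i).
  - suff [] : open_subgroup (\bigcap_i W i) by [].
    apply: open_subgroupS (oU k) _ _; last by move=> u Uu i _; exact: UW.
    split; first by move=> i _; exact: (sW i).1.
    by move=> a b Wa Wb i _; apply: (sW i).2; [exact: Wa|exact: Wb].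
  - by [].
  have [_ [_ Vnx _ _] nWx] := fP _ (oV (n0 + i)%N).
  apply: (nWx k) => //.
    by move=> j /n0P; apply: subset_trans; apply: Vle; exact: leq_addr.
  have : W i.+1 (x (n0 + i)%N).
    apply: (Wi _ _ i.+1 I); exists (x (n0 + i)%N); first exact: Vnx.
    by exists 0; [exact: (oU k).1.1|rewrite addr0].
  rewrite /W addnS => -[v Vv [u Uu vu]].
  exists v => //; exists u => //; split=> //.
  have -> : u = x (n0 + i)%N - v by rewrite -vu addrC addKr.
  by apply: (oV _).1.2 => //; exact: Vdec.
move=> g Vg; apply: U0 => k _; have [n nP] := below k.+1.
by apply: (nP k) => //; exact: Vg.
Qed.

End Splitting.

(** * Discrete cyclic groups and their products *)

Section CyclicGroup.
Variables (G : zmodType) (x : G).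

Definition cyclic_mem : {pred G} := fun y => `[< cyclic_subgroup x y >].

Lemma cyclic_mem_zmod_closed : zmod_closed cyclic_mem.
Proof.
have [C0 CB] := subgroup_cyclic x.
split=> [|y z /asboolP Cy /asboolP Cz]; first exact/asboolP.
by apply/asboolP; exact: CB.
Qed.

HB.instance Definition _ :=
  GRing.isZmodClosed.Build G cyclic_mem cyclic_mem_zmod_closed.

Record cyclic_group := CyclicGroup {
  cyclic_val :> G; cyclic_valP : cyclic_val \in cyclic_mem }.

HB.instance Definition _ := [isSub for cyclic_val].
HB.instance Definition _ := [Choice of cyclic_group by <:].
HB.instance Definition _ := [SubChoice_isSubZmodule of cyclic_group by <:].
HB.instance Definition _ := hasNbhs.Build cyclic_group principal_filter.
HB.instance Definition _ := Discrete_ofNbhs.Build cyclic_group erefl.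

Lemma cyclic_group_sub_continuous :
  continuous (fun z : cyclic_group * cyclic_group => z.1 - z.2).
Proof.
move=> [a b] A /nbhs_singleton /= Aab.
exists ([set a], [set b]); first by split; exact: discrete_set1.
by move=> [_ _] [/= -> ->].
Qed.

HB.instance Definition _ := PreTopologicalNmodule_isTopologicalZmodule.Build
  cyclic_group cyclic_group_sub_continuous.

Lemma cyclic_val_subgroup (c : cyclic_group) : cyclic_subgroup x c.
Proof. exact/asboolP/cyclic_valP. Qed.

Lemma cyclic_group_cyclic : cyclic_zmod cyclic_group.
Proof.
have xC : x \in cyclic_mem by apply/asboolP; exact: cyclic_subgroup_id.
exists (CyclicGroup xC) => c; have [n _ nc] := cyclic_val_subgroup c; exists n.
by apply: val_inj; rewrite raddfMz /= nc.
Qed.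

End CyclicGroup.

Section ProductTopology.
Variables (I : Type) (C : I -> topologicalType).

Lemma coordinate_continuous i : continuous (fun f : prod_topology C => f i).
Proof.
move=> f; have /cvg_sup/(_ i) : nbhs f --> f by exact: cvg_id.
by move=> h; apply: cvg_trans (cvg_app _ h) _; exact: initial_continuous.
Qed.

Lemma prod_topology_continuous (T : topologicalType) (f : T -> prod_topology C) :
  (forall i, continuous (fun t => f t i)) -> continuous f.
Proof.
by move=> fc t; apply/cvg_sup => i; move: t; apply: continuous_comp_initial.
Qed.

End ProductTopology.

(** * The product decomposition attached to a cyclic filtration *)

Section Decomposition.
Variables (G : topologicalZmodType) (V : nat -> set G) (x : nat -> G).
Hypotheses (cG : compact [set: G]) (V0 : V 0%N = setT).
Hypotheses (oV : forall n, open_subgroup (V n)).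
Hypothesis (Vx : forall n, cyclic_splitting (V n) (V n.+1) (x n)).
Hypothesis (Vcap : \bigcap_n V n `<=` [set 0]).

Let C n : topologicalZmodType := cyclic_group (x n).
Implicit Types (a b : prod_topology C) (g h : G).

Let partial_sum a n : G := \sum_(i < n) cyclic_val (a i).

(** The series of the a i converges to g, at the speed given by V. *)
Definition expands a g := forall n, V n (g - partial_sum a n).

Let sV n : subgroup (V n). Proof. by case: (oV n). Qed.

Let Vdec n : V n.+1 `<=` V n. Proof. by case: (Vx n). Qed.

Lemma expandsB a b g h : expands a g -> expands b h -> expands (a - b) (g - h).
Proof.
move=> ag bh n.
have -> : partial_sum (a - b) n = partial_sum a n - partial_sum b n.
  by rewrite /partial_sum -sumrB.
have -> : g - h - (partial_sum a n - partial_sum b n) =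
  (g - partial_sum a n) - (h - partial_sum b n).
  by rewrite !opprB addrACA [RHS]addrACA [- h + _]addrC.
exact: (sV n).2.
Qed.

(** The cosets of V n through the partial sums are nested compact sets. *)
Lemma exists_expands a : exists g, expands a g.
Proof.
apply: contrapT => /forallNP noexp.
have [| | | |n Kn] := @compact_nested_sub G
  (fun n => [set g | V n (g - partial_sum a n)]) set0 cG.
- move=> n g /= Vg.
  have -> : g - partial_sum a n = g - partial_sum a n.+1 + cyclic_val (a n).
    by rewrite /partial_sum big_ord_recr /= opprD addrA subrK.
  apply: subgroupD => //; first exact: Vdec.
  have [_ Vxn _ _] := Vx n; apply: (cyclic_subgroup_sub (sV n) Vxn).
  exact: cyclic_val_subgroup.
- move=> n.
  apply: (@preimage_closed _ _ (fun g : G => g - partial_sum a n) (V n)).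
    by move=> g _; exact: subr_continuous.
  exact: open_subgroup_closed.
- exact: open0.
- by move=> g Vg; apply: (noexp g) => n; exact: Vg.
- by apply: (Kn (partial_sum a n)); rewrite /= subrr; exact: (sV n).1.
Qed.

(** Peel off one component at a time, along V n = V n.+1 (+) <x n>. *)
Lemma exists_expansion g : exists a, expands a g.
Proof.
have peel n r : exists c : C n, V n r -> V n.+1 (r - cyclic_val c).
  have [Vr|] := pselect (V n r); last by exists 0.
  have [_ _ _ /(_ _ Vr)[v Vv [c Cc vc]]] := Vx n.
  have cC : c \in cyclic_mem (x n) by exact/asboolP.
  by exists (CyclicGroup cC) => _ /=; rewrite -vc addrK.
pose F n r := xget 0 [set c : C n | V n r -> V n.+1 (r - cyclic_val c)].
have FP n r : V n r -> V n.+1 (r - cyclic_val (F n r)).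
  by have [c cP] := peel n r; rewrite /F; case: xgetP => [? _ //|/(_ c)].
pose r := fix r n := if n is m.+1 then r m - cyclic_val (F m (r m)) else g.
pose a : prod_topology C := fun n => F n (r n).
exists a => n; have -> : g - partial_sum a n = r n.
  elim: n => [|n IH]; first by rewrite /partial_sum big_ord0 subr0.
  by rewrite /partial_sum big_ord_recr /= opprD addrA -/(partial_sum a n) IH.
by elim: n => [|n IH]; [rewrite V0|exact: FP].
Qed.

(** By induction on i the earlier coordinates vanish, so a i is the difference
of g and g - a i, both in V i.+1, which meets <x i> trivially. *)
Lemma expands_coord0 a g n : expands a g -> V n g ->
  forall i, (i < n)%N -> a i = 0.
Proof.
move=> ag Vg; elim/ltn_ind => i IH lt_in; apply: val_inj => /=.
have Vle : V n `<=` V i.+1.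
  exact: (nested_le (K := V) (@Vdec) lt_in).
have [_ _ VC _] := Vx i; apply: VC; split; last exact: cyclic_val_subgroup.
have := ag i.+1; rewrite /partial_sum big_ord_recr /= big1 ?add0r => [Vga|j _].
  by rewrite -(subKr g (cyclic_val _)); apply: (sV _).2 => //; exact: Vle.
by rewrite IH //; exact: ltn_trans lt_in.
Qed.

Lemma expands_coord a b g h n : expands a g -> expands b h -> V n (g - h) ->
  forall i, (i < n)%N -> a i = b i.
Proof.
move=> ag bh Vgh i lt_in; apply/eqP; rewrite -subr_eq0; apply/eqP.
exact: expands_coord0 (expandsB ag bh) Vgh i lt_in.
Qed.

Lemma expands_near a b g h n : expands a g -> expands b h ->
  (forall i, (i < n)%N -> a i = b i) -> V n (g - h).
Proof.
move=> ag bh ab; rewrite -[g - h]subr0; have := expandsB ag bh n.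
rewrite /partial_sum big1 // => i _.
have /eqP := ab i (ltn_ord i); rewrite -subr_eq0 => /eqP abi.
by rewrite [(a - b) i]abi.
Qed.

Lemma expands_inj a g h : expands a g -> expands a h -> g = h.
Proof.
move=> ag ah; apply/eqP; rewrite -subr_eq0; apply/eqP/Vcap => n _.
exact: expands_near ag ah _.
Qed.

Lemma expansion_inj a b g : expands a g -> expands b g -> a = b.
Proof.
move=> ag bg; apply: functional_extensionality_dep => i.
apply: (expands_coord ag bg) (ltnSn i); rewrite subrr; exact: (sV _).1.
Qed.

Lemma filtration_basis A : nbhs 0 A -> exists n, V n `<=` A.
Proof.
rewrite nbhsE => -[B [oB B0] BA].
have [||n VB] := compact_nested_sub cG (@Vdec) _ oB.
- by move=> n; exact: open_subgroup_closed.
- by move=> g /Vcap ->.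
- by exists n; exact: subset_trans VB BA.
Qed.

Lemma filtration_product : topologically_isomorphic G (prod_topology C).
Proof.
have [f fP] := choice exists_expansion; have [s sP] := choice exists_expands.
exists f, s; split.
- move=> g h; apply: (expansion_inj (fP _)).
  have f0 : expands 0 0.
    by move=> n; rewrite /partial_sum big1 // subr0; exact: (sV n).1.
  have := expandsB (fP g) (expandsB f0 (fP h)).
  by rewrite !sub0r !opprK.
- by move=> g; apply: expands_inj (sP _) (fP g).
- by move=> a; apply: expansion_inj (fP _) (sP a).
- apply: prod_topology_continuous => i g; apply/discrete_cvg.
  apply: filterS (nbhs_translate g (open_subgroup_nbhs (oV i.+1))) => h /= Vhg.
  exact: expands_coord (fP h) (fP g) Vhg i (ltnSn i).
move=> a A nA; have [n VA] : exists n, V n `<=` [set y | A (y + s a)].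
  apply: filtration_basis.
  have := @subr_continuous G (- s a) 0; rewrite /continuous_at /= sub0r opprK.
  by move=> /(_ _ nA).
have Fa : Filter (nbhs a) := nbhs_filter a.
have nb m : \forall b \near a, forall i, (i < m)%N -> b i = a i.
  elim: m => [|m IH]; first by apply: filterE => b i.
  have := @coordinate_continuous _ (C : nat -> topologicalType) m a
    [set a m] (discrete_set1 _).
  apply: filterS2 IH => b ba /= bm i; rewrite ltnS leq_eqVlt => /predU1P[->//|].
  exact: ba.
apply: filterS (nb n) => b ba /=.
by rewrite -[s b](subrK (s a)); apply: VA; exact: expands_near (sP b) (sP a) ba.
Qed.

End Decomposition.

Theorem theorem8p2 (R : realType) (G : topologicalZmodType) :
  compact [set: G] -> metrizable R G -> profinite G ->
  dense (torsion G) ->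
  exists (I : countType) (C : I -> topologicalZmodType),
    (forall i : I, hausdorff_space (C i) /\ cyclic_zmod (C i)) /\
    topologically_isomorphic G (prod_topology C).
Proof.
move=> cG mG pG dG.
have [U [oU U0]] := metrizable_subgroup_sequence pG mG.
have [V [x [V0 oV Vx Vcap]]] := cyclic_filtration pG dG oU U0.
exists nat, (fun n => cyclic_group (x n)); split; last first.
  exact: (filtration_product cG V0 oV Vx Vcap).
move=> n; split; first exact: discrete_hausdorff.
exact: cyclic_group_cyclic.
Qed.
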